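(* Let $a\geq 2$ be a positive integer and let $c$ and $d$ be rational numbers such that $ca$ and $da$ are positive integers. Then the following hold. (1) $$[0;\overline{d a^{k}, c a^{k}}\,]_{k=1}^{\infty}=\frac{\sum_{n=0}^{\infty}\frac{1}{c^{n}d^{n+1}a^{(n+1)^{2}}(1/a;1/a)_{n}}}{\sum_{n=0}^{\infty}\frac{1}{(cd)^{n}a^{n^{2}+n}(1/a;1/a)_{n}}}.$$ (2) $$[0;\overline{c a^{k}}\,]_{k=1}^{\infty}=\frac{\sum_{n=0}^{\infty}\frac{1}{c^{2n+1}a^{2n^2+3n+1}(1/a^{2};1/a^{2})_{n}}}{\sum_{n=0}^{\infty}\frac{1}{c^{2n}a^{2n^{2}+n}(1/a^{2};1/a^{2})_{n}}}.$$ (3) If $ca>1$, then $$[0;ca-1,\overline{1,ca^{k+1}-2}\,]_{k=1}^{\infty}=\frac{\sum_{n=0}^{\infty}\frac{(-1)^{n}}{c^{2n+1}a^{2n^2+3n+1}(1/a^{2};1/a^{2})_{n}}}{\sum_{n=0}^{\infty}\frac{(-1)^{n}}{c^{2n}a^{2n^{2}+n}(1/a^{2};1/a^{2})_{n}}}.$$ (4) If $da>1$ and $ca>2$, then $$[0;da-1,1,ca-2,\overline{1,da^{k+1}-2,1,ca^{k+1}-2}\,]_{k=1}^{\infty}=\frac{\sum_{n=0}^{\infty}\frac{(-1)^{n}}{c^{n}d^{n+1}a^{(n+1)^{2}}(1/a;1/a)_{n}}}{\sum_{n=0}^{\infty}\frac{(-1)^{n}}{(cd)^{n}a^{n^{2}+n}(1/a;1/a)_{n}}}.$$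 (5) If $c>1$ is an integer and $da>1$, then $$[c-1;\overline{1,d a^{k}-1, c a^{k}-1}\,]_{k=1}^{\infty}=\frac{\sum_{n=0}^{\infty}\frac{(-1)^{n}}{c^{n-1}d^{n}a^{n^{2}}(-1/a;-1/a)_{n}}}{\sum_{n=0}^{\infty}\frac{1}{(cd)^{n}a^{n^{2}+n}(-1/a;-1/a)_{n}}}.$$
   Context: $[a_0;a_1,a_2,\ldots]$ denotes the (value of the) infinite regular continued fraction $a_0+\cfrac{1}{a_1+\cfrac{1}{a_2+\cdots}}$. The notation $[a_0;a_1,\ldots,a_j,\overline{f_1(k),\ldots,f_r(k)}\,]_{k=1}^{\infty}$ means that after $a_j$ the partial quotients are $f_1(1),\ldots,f_r(1),f_1(2),\ldots,f_r(2),f_1(3),\ldots$, i.e. the blocks $f_1(k),\ldots,f_r(k)$ for $k=1,2,3,\ldots$ concatenated in order. For complex $x,q$: $(x;q)_0:=1$ and $(x;q)_n:=\prod_{j=0}^{n-1}(1-xq^{j})$ for $n\ge 1$. *)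

(* Defs.v *)
From mathcomp Require Import all_boot all_order all_algebra.
From mathcomp Require Import all_classical all_reals all_analysis.

Set Implicit Arguments.
Unset Strict Implicit.
Unset Printing Implicit Defensive.

Import Order.TTheory GRing.Theory Num.Theory.
Import numFieldNormedType.Exports.

Local Open Scope classical_set_scope.
Local Open Scope ring_scope.

Definition qpoch (R : pzRingType) (x q : R) (n : nat) : R :=
  \prod_(j < n) (1 - x * q ^+ j).

(* The n-th convergent [b 0; b 1, ..., b n]. *)
Fixpoint convergent (R : unitRingType) (b : nat -> R) (n : nat) : R :=
  if n is m.+1 then b 0%N + (convergent (fun i => b i.+1) m)^-1 else b 0%N.

(* The sequence pre, f 1, f 2, f 3, ... of concatenated blocks, that is,
   pre`_0; pre`_1, ..., followed by the overlined f(k) for k = 1, 2, ... *)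
Definition cf_blocks (R : nmodType) (pre : seq R) (r : nat)
    (f : nat -> r.-tuple R) (n : nat) : R :=
  if (n < size pre)%N then pre`_n
  else let m := (n - size pre)%N in (f (m %/ r).+1)`_(m %% r).

Definition regular_cf (R : realType) (b : nat -> R) : Prop :=
  (forall n, b n \is a Num.int) /\ (forall n, (0 < n)%N -> 1 <= b n).

(* "[b 0; b 1, b 2, ...] = (\sum_n u n) / (\sum_n v n)". Since limn and the
   division are total, the statement that both sides are meaningful is made
   part of the assertion. *)
Definition cf_eq_series_ratio (R : realType) (b u v : nat -> R) : Prop :=
  [/\ regular_cf b,
      cvgn (series u),
      cvgn (series v),
      limn (series v) != 0
    & convergent b n @[n --> \oo] --> limn (series u) / limn (series v)].

(* Main.v *)
Require Import Defs.
From mathcomp Require Import all_boot all_order all_algebra.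
From mathcomp Require Import all_classical all_reals all_analysis.
From mathcomp Require Import ring lra zify.

(** All five identities come from one three-term recurrence. For [|q| < 1] put
    [F m = \sum_n x^n q^(n^2 + m n) / (q; q)_n]. Cancelling the factor [1 - q^n]
    in [F m - F m.+1] gives [F m = F m.+1 + x q^(m.+1) F m.+2] ([qsum_rec]), so
    [F m / F m.+1] has the continued fraction
    [1 + x q^(m.+1) / (1 + x q^(m.+2) / (1 + ...))].

    Let [e] be positive partial quotients such that
    [e m * e m.+1 * x * q^(m.+1)] is 1 or -1. The rescaled sums
    [p m = F m / (e 0 * ... * e (m - 1))] then satisfy
    [p m = e m * p m.+1 +/- p m.+2] ([remainder_rec]): they are the remainders
    of the continued fraction with entries [e m] and these signs. The choices
    are
    - [e = C, D A, C A, D A^2, C A^2, ...] in the first, fourth and fifth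
      identities, with [x = 1 / (C D)] and [q = 1 / A] in the first,
      [x = - 1 / (C D)] and [q = 1 / A] in the fourth, [x = 1 / (C D)] and
      [q = - 1 / A] in the fifth;
    - [e = C, C A, C A^2, ...] and [q = 1 / A^2] in the second and third, with
      [x = A / C^2] and [x = - A / C^2] respectively.

    Since [F m] tends to 1, the [p m] are positive and decreasing for large [m],
    and the recurrence carries this down to [m = 1] ([remainder_decr]). Where a
    sign is negative, [y - 1 / z = y - 1 + 1 / (1 + 1 / (z - 1))] turns the
    signed expansion into a regular one, and decreasing [p] is exactly what
    keeps the new remainders, among them the differences [p m - p m.+1],
    positive ([cf_value_pos], [cf_value_neg], [cf_value_alt]). Finally, a
    sequence of positive remainders forces the convergents to converge to the
    quotient of the first two ([convergent_cvg]); the limit is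
    [F 2 / (e 1 * F 1)] in the first four identities and [e 0 * F 0 / F 1] in
    the fifth. *)

Set Implicit Arguments.
Unset Strict Implicit.
Unset Printing Implicit Defensive.

Import Order.TTheory GRing.Theory Num.Theory.
Import numFieldNormedType.Exports.

Local Open Scope ring_scope.

(** * Convergents and complete quotients *)

Lemma convergent_ge1 (R : realType) (b : nat -> R) n :
  (forall i, 1 <= b i) -> 1 <= convergent b n.
Proof.
elim: n b => [|n IHn] b b_ge1 //=.
apply: (le_trans (b_ge1 0%N)); rewrite lerDl invr_ge0.
exact/(le_trans ler01)/IHn.
Qed.

(** Two steps of the expansion shrink the error by a factor of at least 4: the
    error is divided by [x 1 * x 2] and by the product of the two matching
    convergents, and each product has the form [b 1 * y + 1] with [b 1 >= 1]
    and [y >= 1], so it is at least 2. *)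
Lemma convergent_error (R : realType) (b x : nat -> R) n :
  (forall i, x i = b i + (x i.+1)^-1) -> (forall i, 0 < x i.+1) ->
  (forall i, 1 <= b i.+1) -> `|x 0%N - convergent b n| <= 2 / 2 ^+ n.
Proof.
have [m] := ubnP n; elim: m n b x => // m IHm n b x ltnm xE x_gt0 b_ge1.
have x_ge1 i : 1 <= x i.+1.
  by rewrite xE (le_trans (b_ge1 i))// lerDl invr_ge0 ltW.
have xx_ge2 : 2 <= x 1%N * x 2%N.
  rewrite [x 1%N]xE mulrDl mulVf ?gt_eqF//.
  by have := b_ge1 0%N; have := x_ge1 1%N; nra.
case: n ltnm => [_|[_|n ltnm]].
- rewrite /= {1}xE addrAC subrr add0r expr0 divr1.
  rewrite ger0_norm; last by rewrite invr_ge0 ltW.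
  by apply: (@le_trans _ _ 1); rewrite ?ler1n// invf_le1.
- have b1_gt0 : 0 < b 1%N by exact: lt_le_trans ltr01 (b_ge1 _).
  have -> : x 0%N - convergent b 1 = - ((x 1%N * x 2%N)^-1 / b 1%N).
    rewrite /= [x 0%N]xE invfM [x 2%N in RHS]lock.
    have -> : (locked (x 2%N))^-1 = x 1%N - b 1%N.
      by rewrite -lock [x 1%N]xE addrAC subrr add0r.
    by field; rewrite !gt_eqF.
  rewrite normrN expr1 divff// ger0_norm; last first.
    by rewrite divr_ge0 ?invr_ge0 ?ltW// mulr_gt0.
  rewrite -invfM invf_le1 ?mulr_gt0//.
  by have := b_ge1 0%N; nra.
pose y := convergent (fun i => b i.+2) n.
have y_ge1 : 1 <= y by exact: convergent_ge1.
have y_gt0 : 0 < y by exact: lt_le_trans y_ge1.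
have yy_ge2 : 2 <= b 1%N * y + 1 by have := b_ge1 0%N; nra.
have -> : x 0%N - convergent b n.+2 =
    (x 2%N - y) / (x 1%N * x 2%N * (b 1%N * y + 1)).
  rewrite /= -/y [x 0%N]xE [x 1%N]xE; field.
  have x2_gt0 := x_gt0 1%N.
  by rewrite !gt_eqF//; have := b_ge1 0%N; nra.
have IH := IHm n (fun i => b i.+2) (fun i => x i.+2).
rewrite normrM normfV [`|x 1%N * _ * _|]ger0_norm; last by nra.
rewrite ler_pdivrMr; last by nra.
rewrite !exprS; have -> : 2 / (2 * (2 * 2 ^+ n)) = (2 / 2 ^+ n) / 4 :> R.
  by field; rewrite expf_eq0/= pnatr_eq0 andbF.
have {}IH : `|x 2%N - y| <= 2 / 2 ^+ n by apply: IH => //; lia.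
apply: (le_trans IH).
have : 0 <= 2 / 2 ^+ n :> R by rewrite divr_ge0// exprn_ge0.
have : 4 <= x 1%N * x 2%N * (b 1%N * y + 1) by nra.
move: (_ * (_ * _ + _)) (2 / _) => u v; nra.
Qed.

(** Homogeneous form of the same fact, with [x n = P n / P n.+1]. The numbers
    [P n] occur linearly, so a regular expansion can be verified through sums
    and differences alone, without inverting anything. *)
Lemma convergent_cvg (R : realType) (b P : nat -> R) :
  (forall n, P n = b n * P n.+1 + P n.+2) -> (forall n, 0 < P n.+1) ->
  (forall n, 1 <= b n.+1) ->
  (convergent b n @[n --> \oo] --> P 0%N / P 1%N)%classic.
Proof.
move=> PE P_gt0 b_ge1.
pose x n := P n / P n.+1.
have xE n : x n = b n + (x n.+1)^-1.
  by rewrite /x {1}PE mulrDl mulfK ?gt_eqF// invf_div.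
have x_gt0 n : 0 < x n.+1 by rewrite divr_gt0.
apply/cvgrPdist_le => eps eps_gt0.
have h : (((fun n => 2 * (1 / 2) ^+ n) : nat -> R) @ \oo -->
  (2 * 0 : R))%classic.
  apply: cvgMl_tmp; apply: cvg_expr; rewrite ger0_norm; lra.
move: h; rewrite mulr0 => /cvgr0Pnorm_le /(_ eps eps_gt0).
apply: filterS => n; apply: le_trans.
rewrite -[P 0%N / _]/(x 0%N) (le_trans (convergent_error n xE x_gt0 b_ge1))//.
by rewrite div1r exprVn ler_norm.
Qed.

(** * The q-series and its three-term recurrence *)

(** With [F z = \sum_n x^n q^(n^2) z^n / (q; q)_n], the Rogers-Ramanujan type
    function, this is the general term of [F (q^m)]. *)
Definition qterm (R : realType) (x q : R) (m n : nat) : R :=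
  x ^+ n * q ^+ (n ^ 2 + m * n) / qpoch q q n.

Definition qsum (R : realType) (x q : R) (m : nat) : R :=
  limn (series (qterm x q m)).

Lemma qpoch_bound (R : realType) (q : R) n : `|q| <= 1 / 2 ->
  1 / 2 ^+ n <= `|qpoch q q n|.
Proof.
move=> q_le; elim: n => [|n IHn]; first by rewrite /qpoch big_ord0 normr1 divr1.
rewrite /qpoch big_ord_recr/= -/(qpoch q q n) -exprS normrM.
have : 1 / 2 <= `|1 - q ^+ n.+1|.
  have : `|q ^+ n.+1| <= 1 / 2.
    rewrite exprS normrM normrX (le_trans _ q_le)// ler_piMr//.
    by rewrite exprn_ile1//; lra.
  have := lerB_dist 1 (q ^+ n.+1); rewrite normr1; lra.
move=> factor_ge; rewrite exprSr.
rewrite (_ : 1 / _ = 1 / 2 ^+ n * (1 / 2)); last by rewrite mulf_div mulr1.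
by apply: ler_pM => //; rewrite ?divr_ge0// exprn_ge0.
Qed.

Lemma qpoch_neq0 (R : realType) (q : R) n : `|q| <= 1 / 2 -> qpoch q q n != 0.
Proof.
move=> /(qpoch_bound n) h; rewrite -normr_gt0 (lt_le_trans _ h)//.
Qed.

(** The terms of index [n.+1] for [m.+1] and [m] have quotient [q^(n.+1)], so
    their difference carries a factor [1 - q^(n.+1)], which cancels the last
    factor of [(q; q)_(n.+1)]. *)
Lemma qterm_rec (R : realType) (x q : R) m n : `|q| <= 1 / 2 ->
  qterm x q m n.+1 = qterm x q m.+1 n.+1 + x * q ^+ m.+1 * qterm x q m.+2 n.
Proof.
move=> q_le; have := @qpoch_neq0 _ q n.+1 q_le.
rewrite /qterm /qpoch big_ord_recr /= -/(qpoch q q n) -exprS mulf_eq0 negb_or.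
case/andP=> Q0 q0.
rewrite (_ : n.+1 ^ 2 + m.+1 * n.+1 = n.+1 ^ 2 + m * n.+1 + n.+1)%N; last lia.
rewrite (_ : n.+1 ^ 2 + m * n.+1 = m.+1 + (n ^ 2 + m.+2 * n))%N; last nia.
rewrite !(exprD q) [x ^+ n.+1]exprS.
by field; rewrite Q0.
Qed.

(** The powers of 2 pay for the q-Pochhammer symbol in the denominator. The
    bound is geometric only once [m] is large; smaller [m] are reached from
    there through the recurrence. *)
Lemma qterm_bound (R : realType) (x q : R) m n : `|q| <= 1 / 2 ->
  `|qterm x q m n| <= (2 * `|x| * `|q| ^+ m.+1) ^+ n.
Proof.
move=> q_le; case: n => [|n].
  by rewrite /qterm /qpoch big_ord0 muln0 !expr0 divr1 mulr1 normr1.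
have Q := @qpoch_bound _ q n.+1 q_le.
have Q0 : 0 < `|qpoch q q n.+1| by rewrite normr_gt0 qpoch_neq0.
rewrite /qterm normrM normfV ler_pdivrMr// normrM !normrX.
have e2 : (2 ^+ n.+1 : R) * (1 / 2 ^+ n.+1) = 1.
  by rewrite mul1r divff// expf_eq0/= pnatr_eq0.
rewrite exprMn exprMn -!exprM.
have h1 : `|q| ^+ (n.+1 ^ 2 + m * n.+1) <= `|q| ^+ (m.+1 * n.+1).
  by apply: ler_wiXn2l => //; [lra | nia].
have h2 : 1 <= 2 ^+ n.+1 * `|qpoch q q n.+1|.
  by rewrite -[X in X <= _]e2 ler_wpM2l// exprn_ge0.
have h3 : 0 <= `|x| ^+ n.+1 by rewrite exprn_ge0.
have h4 : 0 <= `|q| ^+ (m.+1 * n.+1) by rewrite exprn_ge0.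
apply: (le_trans (ler_wpM2l h3 h1)).
rewrite (_ : _ * _ * _ * _ = `|x| ^+ n.+1 * `|q| ^+ (m.+1 * n.+1) *
   (2 ^+ n.+1 * `|qpoch q q n.+1|)); last ring.
by rewrite ler_peMr// mulr_ge0.
Qed.

Lemma series_qterm1 (R : realType) (x q : R) m : series (qterm x q m) 1%N = 1.
Proof.
rewrite seriesEnat /= big_nat1 /qterm /qpoch big_ord0 muln0 !expr0.
by rewrite mulr1 divr1.
Qed.

(** The term of index 0 is 1, and [1 / 7] is the sum of [(1 / 8)^n] over
    [n >= 1]. The later comparison of [2 * qsum x q m] with [qsum x q m.+1]
    needs a bound below [1 / 3]. *)
Lemma qsum_near1 (R : realType) (x q : R) m : `|q| <= 1 / 2 ->
  2 * `|x| * `|q| ^+ m.+1 <= 1 / 8 ->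
  cvgn (series (qterm x q m)) /\ `|qsum x q m - 1| <= 1 / 7.
Proof.
move=> q_le small.
have le_geo n : `|qterm x q m n| <= (1 / 8) ^+ n.
  apply: (le_trans (qterm_bound x m n q_le)).
  by apply: lerXn2r; rewrite ?nnegrE// mulr_ge0 ?mulr_ge0 ?exprn_ge0.
have cvg_t : cvgn (series (qterm x q m)).
  apply: normed_cvg; apply: (@series_le_cvg _ _ (geometric 1 (1 / 8))).
  - by move=> n; exact: normr_ge0.
  - by move=> n; rewrite geometric_ge0.
  - by move=> n; rewrite /= mul1r.
  - by apply: is_cvg_geometric_series; rewrite ger0_norm; lra.
split=> //.
(* the right-hand side is the sum of the first n powers (1 / 8) ^+ i, i >= 1 *)
have near n : `|series (qterm x q m) n.+1 - 1| <= 1 / 7 - 1 / 7 * (1 / 8) ^+ n.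
  elim: n => [|n IHn].
    by rewrite series_qterm1 expr0 mulr1 !subrr normr0.
  rewrite seriesSr addrAC (le_trans (ler_normD _ _))//.
  by have := le_geo n.+1; move: IHn; rewrite exprS; lra.
have near' :
    (\forall n \near \oo, `|series (qterm x q m) n - 1| <= 1 / 7)%classic.
  exists 1%N => // -[|n] //= _; apply: (le_trans (near n)).
  by rewrite gerBl mulr_ge0// exprn_ge0.
rewrite ler_distl; apply/andP; split.
- by apply: limr_ge => //; apply: filterS near' => n;
  rewrite ler_distl => /andP[].
- by apply: limr_le => //; apply: filterS near' => n;
  rewrite ler_distl => /andP[].
Qed.

Lemma qsum_near1_eventually (R : realType) (x q : R) : `|q| <= 1 / 2 ->
  exists N, forall m, (N <= m)%N ->
  cvgn (series (qterm x q m)) /\ `|qsum x q m - 1| <= 1 / 7.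
Proof.
move=> q_le.
have q_lt1 : `| `|q| | < 1 by rewrite normr_id; lra.
have : (((fun n => (2 * `|x|) * `|q| ^+ n) : nat -> R) @ \oo -->
  (2 * `|x| * 0 : R))%classic.
  by apply: cvgMl_tmp; exact: cvg_expr.
rewrite mulr0 => /cvgr0Pnorm_le /(_ (1 / 8)) [|N _ small]; first lra.
exists N => m leNm; apply: qsum_near1 => //.
by apply: (le_trans (ler_norm _)); apply: small => /=; exact: leqW.
Qed.

(** What is clear for large indices propagates down the three-term
    recurrence; both the convergence of the series and the monotonicity of the
    remainders are obtained in this way. *)
Lemma backward_ind (P : nat -> Prop) N n0 :
  (forall m, (N <= m)%N -> P m) ->
  (forall m, (n0 <= m)%N -> P m.+1 -> P m.+2 -> P m) ->
  forall m, (n0 <= m)%N -> P m.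
Proof.
move=> PN PS m; have [k] := ubnP (N - m); elim: k m => // k IHk m lek len0.
have [/PN //|ltmN] := leqP N m.
by apply: PS => //; apply: IHk; lia.
Qed.

Lemma qsum_rec_cvg (R : realType) (x q : R) m : `|q| <= 1 / 2 ->
  cvgn (series (qterm x q m.+1)) -> cvgn (series (qterm x q m.+2)) ->
  (series (qterm x q m) n @[n --> \oo] -->
    qsum x q m.+1 + x * q ^+ m.+1 * qsum x q m.+2)%classic.
Proof.
move=> q_le cvg1 cvg2.
rewrite -cvg_shiftS.
have -> : (fun n => series (qterm x q m) n.+1) =
    (fun n => series (qterm x q m.+1) n.+1
              + x * q ^+ m.+1 * series (qterm x q m.+2) n).
  apply/funext; elim=> [|n IHn].
    by rewrite !series_qterm1 seriesEnat /= big_geq// mulr0 addr0.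
  by rewrite seriesSr IHn qterm_rec// !(seriesSr _ n)
     (seriesSr _ n.+1) seriesSr; ring.
apply: cvgD; last by apply: cvgMl_tmp.
by rewrite (cvg_shiftS (series (qterm x q m.+1))).
Qed.

Lemma qsum_cvg (R : realType) (x q : R) m : `|q| <= 1 / 2 ->
  cvgn (series (qterm x q m)).
Proof.
move=> q_le; have [N near] := qsum_near1_eventually x q_le.
apply: (@backward_ind (fun m => cvgn (series (qterm x q m))) N 0) => //.
- by move=> k /near[].
- by move=> k _ h1 h2; apply/cvgP/qsum_rec_cvg.
Qed.

Lemma qsum_rec (R : realType) (x q : R) m : `|q| <= 1 / 2 ->
  qsum x q m = qsum x q m.+1 + x * q ^+ m.+1 * qsum x q m.+2.
Proof.
move=> q_le; apply: cvg_lim => //.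
by apply: qsum_rec_cvg => //; exact: qsum_cvg.
Qed.

(** * Remainders of the signed continued fraction *)

(** Dividing by the partial quotients [e j] normalises the recurrence of
    [qsum] to [p m = e m * p m.+1 +/- p m.+2], the recurrence of the continued
    fraction [e 0 +/- 1 / (e 1 +/- 1 / (e 2 +/- ...))], whose complete
    quotients are therefore the ratios [p m / p m.+1]. *)
Definition remainder (R : realType) (e : nat -> R) (x q : R) (m : nat) : R :=
  qsum x q m / \prod_(j < m) e j.

Lemma remainder_rec (R : realType) (e : nat -> R) (s : nat -> bool)
    (x q : R) m :
  `|q| <= 1 / 2 -> (forall m, 0 < e m) ->
  (forall m, e m * e m.+1 * (x * q ^+ m.+1) = (-1) ^+ s m) ->
  remainder e x q m =
    e m * remainder e x q m.+1 + (-1) ^+ s m * remainder e x q m.+2.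
Proof.
move=> q_le e_gt0 eeE; rewrite /remainder (qsum_rec x m q_le) !big_ord_recr /=.
have P0 : \prod_(j < m) e j != 0 by apply/prodf_neq0 => i _; rewrite gt_eqF.
rewrite -eeE; have := e_gt0 m; have := e_gt0 m.+1; move: (\prod_(_ < _) _) P0.
by move=> P P0 /gt_eqF/negbT e1 /gt_eqF/negbT e0; field; rewrite P0 e0 e1.
Qed.

(** For large [m] the sums are close to 1 while [e m >= 2], which gives the
    inequalities. Going down, [p m = e m * p m.+1 +/- p m.+2] exceeds
    [p m.+1] because [e m >= 1], and [e m >= 2] where the sign is negative. *)
Lemma remainder_decr (R : realType) (e : nat -> R) (s : nat -> bool) (x q : R) :
  `|q| <= 1 / 2 -> (forall m, 0 < e m) ->
  (forall m, e m * e m.+1 * (x * q ^+ m.+1) = (-1) ^+ s m) ->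
  (forall m, 1 + (s m.+1)%:R <= e m.+1) -> (forall m, 2 <= e m.+3) ->
  forall m, 0 < remainder e x q m.+2 < remainder e x q m.+1.
Proof.
move=> q_le e_gt0 eeE e_ge e_ge2 m.
have [N near] := qsum_near1_eventually x q_le.
pose Q m := 0 < remainder e x q m.+1 < remainder e x q m.
suff : Q m.+1 by [].
apply: (@backward_ind Q (N + 3) 1) => // [{}m lem | [//|{}m] _ /andP[h1 h2] _].
  have P0 : 0 < \prod_(j < m) e j by apply: prodr_gt0 => i _.
  rewrite /Q /remainder big_ord_recr /= invfM mulrA.
  have [_ h1] := near m.+1 ltac:(lia); have [_ h0] := near m ltac:(lia).
  (* the shift by 3 puts [m] in the range where [e m >= 2] is assumed *)
  have e2 : 2 <= e m.
    by have := e_ge2 (m - 3)%N; have -> : ((m - 3).+3 = m)%N by lia.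
  move: h0 h1; rewrite !ler_distl => /andP[? ?] /andP[? ?].
  rewrite !divr_gt0 ?ltr_pdivrMr//=; last lra.
  by rewrite mulrAC divfK ?gt_eqF//; nra.
apply/andP; split; first exact: lt_trans h2.
rewrite [ltRHS](remainder_rec _ q_le e_gt0 eeE).
by move: (e_ge m); case: (s m.+1); rewrite ?expr1 ?expr0 /=; nra.
Qed.

(** * From the signed to the regular continued fraction *)

Lemma cf_blocks_at (R : nmodType) (pre : seq R) r
    (f : nat -> r.-tuple R) k i n :
  n = (size pre + (k * r + i))%N -> (i < r)%N ->
  cf_blocks pre f n = (f k.+1)`_i.
Proof.
move=> -> lt_ir; rewrite /cf_blocks ltnNge leq_addr /= addKn.
by rewrite divnMDl ?(leq_ltn_trans _ lt_ir)// divn_small// addn0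
  modnMDl modn_small.
Qed.

Lemma blocks_ind (Q : nat -> Prop) j r : (0 < r)%N ->
  (forall n, (n < j)%N -> Q n) ->
  (forall k i, (i < r)%N -> Q (j + (k * r + i))%N) -> forall n, Q n.
Proof.
move=> r_gt0 Qpre Qrep n; have [/Qpre//|le_jn] := ltnP n j.
by rewrite -(subnKC le_jn) (divn_eq (n - j) r); apply: Qrep; rewrite ltn_mod.
Qed.

Definition cf_value (R : realType) (b : nat -> R) (l : R) : Prop :=
  regular_cf b /\ (convergent b n @[n --> \oo] --> l)%classic.

Lemma cf_value_rec (R : realType) (b P : nat -> R) :
  (forall n, b n \is a Num.int) -> (forall n, 1 <= b n.+1) ->
  (forall n, P n = b n * P n.+1 + P n.+2) -> (forall n, 0 < P n.+1) ->
  cf_value b (P 0%N / P 1%N).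
Proof.
move=> b_int b_ge1 PE P_gt0; split; last exact: convergent_cvg.
by split=> // -[|n].
Qed.

Lemma cf_value_pos (R : realType) (b e p : nat -> R) :
  (forall m, e m.+1 \is a Num.int) -> (forall m, 1 <= e m.+1) ->
  (forall m, p m.+1 = e m.+1 * p m.+2 + p m.+3) ->
  (forall m, 0 < p m.+2 < p m.+1) ->
  b 0%N = 0 -> (forall m, b m.+1 = e m.+1) ->
  cf_value b (p 2%N / p 1%N).
Proof.
move=> e_int e_ge1 pE p_decr b0 bE.
apply: (@cf_value_rec _ _ (fun n => if n is m.+1 then p m.+1 else p 2%N)).
- by case=> [|m]; rewrite ?b0 ?bE ?int_num0.
- by move=> m; rewrite bE.
- by case=> [|m]; rewrite ?b0 ?bE ?mul0r ?add0r -?pE.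
- by move=> m; case/andP: (p_decr m); exact: lt_trans.
Qed.

(** The identity [x - 1 / y = x - 1 + 1 / (1 + 1 / (y - 1))] puts a partial
    quotient 1 between any two consecutive entries and lowers both neighbours
    by 1, hence inner entries by 2. On remainders it inserts the differences:
    [p 2, p 1, p 2, p 2 - p 3, p 3, p 3 - p 4, ...]. *)
Lemma cf_value_neg (R : realType) (b e p : nat -> R) :
  (forall m, e m.+1 \is a Num.int) -> 2 <= e 1%N -> (forall m, 3 <= e m.+2) ->
  (forall m, p m.+1 = e m.+1 * p m.+2 - p m.+3) ->
  (forall m, 0 < p m.+2 < p m.+1) ->
  b 0%N = 0 -> b 1%N = e 1%N - 1 ->
  (forall m, b (2 + (m * 2 + 0))%N = 1) ->
  (forall m, b (2 + (m * 2 + 1))%N = e m.+2 - 2) ->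
  cf_value b (p 2%N / p 1%N).
Proof.
move=> e_int e1_ge e_ge pE p_decr b0 b1 b_even b_odd.
pose P := cf_blocks [:: p 2%N; p 1%N] (fun k =>
  [tuple p k.+1; p k.+1 - p k.+2]).
apply: (@cf_value_rec _ _ P).
- apply: (@blocks_ind _ 2 2) => // [[|[|//]] _|m [|[|//]] _];
    by rewrite ?b0 ?b1 ?b_even ?b_odd ?rpred0 ?rpred1 ?rpredB ?rpred1
      ?rpred_nat.
- case=> [|n]; first by rewrite b1; lra.
  move: n; apply: (@blocks_ind _ 0 2) => // m [|[|//]] _.
    by have := b_even m; rewrite add0n => ->.
  by have := b_odd m; rewrite add0n => ->; have := e_ge m; lra.
- have P0 m : P (2 + (m * 2 + 0))%N = p m.+2.
    by rewrite /P (@cf_blocks_at _ _ _ _ m 0).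
  have P1 m : P (2 + (m * 2 + 1))%N = p m.+2 - p m.+3.
    by rewrite /P (@cf_blocks_at _ _ _ _ m 1).
  apply: (@blocks_ind _ 2 2) => // [[|[|//]] _|m [|[|//]] _].
  + by rewrite b0 mul0r add0r; have := P0 0%N => /= ->.
  + have := P0 0%N; have := P1 0%N => /= -> ->.
    by rewrite b1 [P 1%N]pE; ring.
  + rewrite (_ : (2 + (m * 2 + 0)).+1 = 2 + (m * 2 + 1))%N; last lia.
    rewrite (_ : (2 + (m * 2 + 1)).+1 = 2 + (m.+1 * 2 + 0))%N; last lia.
    by rewrite !P0 P1 b_even; ring.
  + rewrite P1 b_odd.
    rewrite (_ : (2 + (m * 2 + 1)).+1 = 2 + (m.+1 * 2 + 0))%N; last lia.
    rewrite (_ : (2 + (m.+1 * 2 + 0)).+1 = 2 + (m.+1 * 2 + 1))%N; last lia.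
    by rewrite P0 P1 [p m.+2]pE; ring.
- apply: (@blocks_ind _ 1 2) => // [[|//] _|m [|[|//]] _].
  + by case/andP: (p_decr 0%N); exact: lt_trans.
  + by rewrite /P (@cf_blocks_at _ _ _ _ m 0)//=; case/andP: (p_decr m).
  + rewrite /P (@cf_blocks_at _ _ _ _ m 1)//= subr_gt0.
    by case/andP: (p_decr m.+1).
Qed.

(** Here [x - 1 / y = x - 1 + 1 / (1 + 1 / (y - 1))] is used at every other
    step, so that the regular remainders are
    [p 0, p 1, p 1 - p 2, p 2, p 3, p 3 - p 4, p 4, ...]. *)
Lemma cf_value_alt (R : realType) (b e p : nat -> R) :
  (forall m, e m \is a Num.int) -> (forall m, 2 <= e m.+1) ->
  (forall m, p m = e m * p m.+1 + (-1) ^+ (~~ odd m) * p m.+2) ->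
  (forall m, 0 < p m.+2 < p m.+1) ->
  b 0%N = e 0%N - 1 ->
  (forall m, b (1 + (m * 3 + 0))%N = 1) ->
  (forall m, b (1 + (m * 3 + 1))%N = e m.*2.+1 - 1) ->
  (forall m, b (1 + (m * 3 + 2))%N = e m.*2.+2 - 1) ->
  cf_value b (p 0%N / p 1%N).
Proof.
move=> e_int e_ge pE p_decr b0 b1 b2 b3.
(* blocks are numbered from 1, hence the predecessors *)
pose P := cf_blocks [:: p 0%N] (fun k =>
  [tuple p k.-1.*2.+1; p k.-1.*2.+1 - p k.-1.*2.+2; p k.-1.*2.+2]).
have P1 m : P (1 + (m * 3 + 0))%N = p m.*2.+1.
  by rewrite /P (@cf_blocks_at _ _ _ _ m 0).
have P2 m : P (1 + (m * 3 + 1))%N = p m.*2.+1 - p m.*2.+2.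
  by rewrite /P (@cf_blocks_at _ _ _ _ m 1).
have P3 m : P (1 + (m * 3 + 2))%N = p m.*2.+2.
  by rewrite /P (@cf_blocks_at _ _ _ _ m 2).
have -> : p 1%N = P 1%N by rewrite -(P1 0%N).
apply: (@cf_value_rec _ _ P).
- apply: (@blocks_ind _ 1 3) => // [[|//] _|m [|[|[|//]]] _];
    by rewrite ?b0 ?b1 ?b2 ?b3 ?rpred1 ?rpredB ?rpred1.
- apply: (@blocks_ind _ 0 3) => // m [|[|[|//]]] _; rewrite add0n -add1n.
  + by rewrite b1.
  + by rewrite b2; have := e_ge m.*2; lra.
  + by rewrite b3; have := e_ge m.*2.+1; lra.
- apply: (@blocks_ind _ 1 3) => // [[|//] _|m [|[|[|//]]] _].
  + have := P1 0%N; have := P2 0%N => /= -> ->.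
    by rewrite b0 [P 0%N]pE /=; ring.
  + rewrite (_ : (1 + (m * 3 + 0)).+1 = 1 + (m * 3 + 1))%N; last lia.
    rewrite (_ : (1 + (m * 3 + 1)).+1 = 1 + (m * 3 + 2))%N; last lia.
    by rewrite P1 P2 P3 b1; ring.
  + rewrite (_ : (1 + (m * 3 + 1)).+1 = 1 + (m * 3 + 2))%N; last lia.
    rewrite (_ : (1 + (m * 3 + 2)).+1 = 1 + (m.+1 * 3 + 0))%N; last lia.
    by rewrite P1 P2 P3 b2 [p m.*2.+1]pE /= odd_double; ring.
  + rewrite (_ : (1 + (m * 3 + 2)).+1 = 1 + (m.+1 * 3 + 0))%N; last lia.
    rewrite (_ : (1 + (m.+1 * 3 + 0)).+1 = 1 + (m.+1 * 3 + 1))%N; last lia.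
    by rewrite P1 P2 P3 b3 [p m.*2.+2]pE /= odd_double; ring.
- apply: (@blocks_ind _ 0 3) => // m [|[|[|//]]] _; rewrite add0n -add1n.
  + by rewrite P1; case/andP: (p_decr m.*2); exact: lt_trans.
  + by rewrite P2 subr_gt0; case/andP: (p_decr m.*2).
  + by rewrite P3; case/andP: (p_decr m.*2).
Qed.

(** * Continued fractions as ratios of q-series *)

Lemma cf_eq_qsum_ratio (R : realType) (b u v : nat -> R) (k x q : R) j :
  `|q| <= 1 / 2 -> qsum x q 1 != 0 ->
  (forall n, u n = k * qterm x q j n) -> (forall n, v n = qterm x q 1 n) ->
  cf_value b (k * qsum x q j / qsum x q 1) -> cf_eq_series_ratio b u v.
Proof.
move=> q_le F1_neq0 uE vE [b_reg b_cvg].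
have -> : v = qterm x q 1 by apply/funext.
have -> : u = k *: qterm x q j by apply/funext.
have cvg_t m : cvgn (series (qterm x q m)) by exact: qsum_cvg.
split=> //.
- exact: is_cvg_seriesZ.
- by rewrite lim_seriesZ.
Qed.

Lemma remainder_ratio21 (R : realType) (e : nat -> R) (x q : R) :
  e 0%N != 0 ->
  remainder e x q 2 / remainder e x q 1 = (e 1%N)^-1 * qsum x q 2 / qsum x q 1.
Proof.
move=> e0; rewrite /remainder !big_ord_recr !big_ord0 /= !mul1r invf_div invfM.
move/mulVf: e0; move: (e 0%N)^-1 (e 1%N)^-1 (qsum x q 1)^-1 => E0 E1 F1 e0.
by rewrite -[RHS]mul1r -e0; ring.
Qed.

Lemma remainder_ratio01 (R : realType) (e : nat -> R) (x q : R) :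
  remainder e x q 0 / remainder e x q 1 = e 0%N * qsum x q 0 / qsum x q 1.
Proof.
rewrite /remainder !big_ord_recr !big_ord0 /= !mul1r divr1 invf_div.
by rewrite mulrCA mulrA.
Qed.

Lemma qsum1_neq0 (R : realType) (e : nat -> R) (x q : R) :
  (0 < remainder e x q 2 < remainder e x q 1) -> qsum x q 1 != 0.
Proof.
case/andP=> h /(lt_trans h) {h}; apply: contraTneq => F0.
by rewrite /remainder F0 mul0r ltxx.
Qed.

Lemma cf_eq_pos (R : realType) (b u v e : nat -> R) (x q : R) :
  `|q| <= 1 / 2 -> (forall m, 0 < e m) ->
  (forall m, e m * e m.+1 * (x * q ^+ m.+1) = 1) ->
  (forall m, e m.+1 \is a Num.int) -> (forall m, 1 <= e m.+1) ->
  (forall m, 2 <= e m.+3) ->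
  b 0%N = 0 -> (forall m, b m.+1 = e m.+1) ->
  (forall n, u n = (e 1%N)^-1 * qterm x q 2 n) ->
  (forall n, v n = qterm x q 1 n) -> cf_eq_series_ratio b u v.
Proof.
move=> q_le e_gt0 eeE e_int e_ge1 e_ge2 b0 bE uE vE.
have rec m := @remainder_rec _ e (fun _ => false) x q m q_le e_gt0 eeE.
have decr : forall m, 0 < remainder e x q m.+2 < remainder e x q m.+1.
  by apply: (@remainder_decr _ e (fun _ => false)) => // m; rewrite addr0.
apply: (cf_eq_qsum_ratio q_le (qsum1_neq0 (decr 0%N)) uE vE).
rewrite -remainder_ratio21 ?gt_eqF//.
apply: (@cf_value_pos _ _ e (remainder e x q)) => // m.
by rewrite rec expr0 mul1r.
Qed.

Lemma cf_eq_neg (R : realType) (b u v e : nat -> R) (x q : R) :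
  `|q| <= 1 / 2 -> (forall m, 0 < e m) ->
  (forall m, e m * e m.+1 * (x * q ^+ m.+1) = -1) ->
  (forall m, e m.+1 \is a Num.int) -> 2 <= e 1%N -> (forall m, 3 <= e m.+2) ->
  b 0%N = 0 -> b 1%N = e 1%N - 1 ->
  (forall m, b (2 + (m * 2 + 0))%N = 1) ->
  (forall m, b (2 + (m * 2 + 1))%N = e m.+2 - 2) ->
  (forall n, u n = (e 1%N)^-1 * qterm x q 2 n) ->
  (forall n, v n = qterm x q 1 n) -> cf_eq_series_ratio b u v.
Proof.
move=> q_le e_gt0 eeE e_int e1_ge e_ge b0 b1 b_even b_odd uE vE.
have rec m := @remainder_rec _ e (fun _ => true) x q m q_le e_gt0 eeE.
have decr : forall m, 0 < remainder e x q m.+2 < remainder e x q m.+1.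
  apply: (@remainder_decr _ e (fun _ => true)) => //= [[|m]|m] //.
    by have := e_ge m; lra.
  by have := e_ge m.+1; lra.
apply: (cf_eq_qsum_ratio q_le (qsum1_neq0 (decr 0%N)) uE vE).
rewrite -remainder_ratio21 ?gt_eqF//.
apply: (@cf_value_neg _ _ e (remainder e x q)) => // m.
by rewrite rec expr1 mulN1r.
Qed.

(** The sign [(-1)^m.+1] is that of [q^m.+1] for a negative base [q]: the signs
    of the expansion are -, +, -, +, ... *)
Lemma cf_eq_alt (R : realType) (b u v e : nat -> R) (x q : R) :
  `|q| <= 1 / 2 -> (forall m, 0 < e m) ->
  (forall m, e m * e m.+1 * (x * q ^+ m.+1) = (-1) ^+ m.+1) ->
  (forall m, e m \is a Num.int) -> (forall m, 2 <= e m.+1) ->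
  b 0%N = e 0%N - 1 ->
  (forall m, b (1 + (m * 3 + 0))%N = 1) ->
  (forall m, b (1 + (m * 3 + 1))%N = e m.*2.+1 - 1) ->
  (forall m, b (1 + (m * 3 + 2))%N = e m.*2.+2 - 1) ->
  (forall n, u n = e 0%N * qterm x q 0 n) ->
  (forall n, v n = qterm x q 1 n) -> cf_eq_series_ratio b u v.
Proof.
move=> q_le e_gt0 eeE e_int e_ge b0 b1 b2 b3 uE vE.
have eeE' m : e m * e m.+1 * (x * q ^+ m.+1) = (-1) ^+ (~~ odd m).
  by rewrite eeE -signr_odd.
have rec m := @remainder_rec _ e (fun m => ~~ odd m) x q m q_le e_gt0 eeE'.
have decr : forall m, 0 < remainder e x q m.+2 < remainder e x q m.+1.
  apply: (@remainder_decr _ e (fun m => ~~ odd m)) => // m.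
  by apply: le_trans (e_ge m); case: odd => /=; lra.
apply: (cf_eq_qsum_ratio q_le (qsum1_neq0 (decr 0%N)) uE vE).
rewrite -remainder_ratio01.
exact: (@cf_value_alt _ _ e (remainder e x q)).
Qed.

(** * Closed forms of the terms *)

(** The sign [eps] is 1 or -1 in the applications. *)
Lemma qterm2E (R : realType) (eps C D A : R) n :
  (D * A)^-1 * qterm (eps / (C * D)) (1 / A) 2 n =
  eps ^+ n / (C ^+ n * D ^+ (n + 1) * A ^+ ((n + 1) ^ 2)
              * qpoch (1 / A) (1 / A) n).
Proof.
rewrite /qterm (_ : (n + 1) ^ 2 = n ^ 2 + 2 * n + 1)%N; last by lia.
rewrite !exprD !expr1 expr_div_n exprMn -!exprD !expr_div_n expr1n !invfM.
by ring.
Qed.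

Lemma qterm1E (R : realType) (eps C D A : R) n :
  qterm (eps / (C * D)) (1 / A) 1 n =
  eps ^+ n / ((C * D) ^+ n * A ^+ (n ^ 2 + n) * qpoch (1 / A) (1 / A) n).
Proof. by rewrite /qterm mul1n !expr_div_n expr1n !invfM; ring. Qed.

(** For [e m = C * A^m] the product [e m * e m.+1] grows like [A^(2 m)], so the
    base is [1 / A^2]; the odd power of [A] left over goes into [x]. *)
Lemma qterm2_squareE (R : realType) (eps C A : R) n : A != 0 ->
  (C * A)^-1 * qterm (eps * A / C ^+ 2) (1 / A ^+ 2) 2 n =
  eps ^+ n / (C ^+ (2 * n + 1) * A ^+ (2 * n ^ 2 + 3 * n + 1)
              * qpoch (1 / A ^+ 2) (1 / A ^+ 2) n).
Proof.
move=> A0; rewrite /qterm !expr_div_n expr1n exprMn -!exprM.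
rewrite (_ : 2 * (n ^ 2 + 2 * n) = n + (2 * n ^ 2 + 3 * n))%N; last lia.
rewrite !(exprD _ _ 1) !expr1 (exprD A n) !invfM.
have h : A ^+ n * (A ^+ n)^-1 = 1 by rewrite mulfV// expf_neq0.
by rewrite -[RHS]mul1r -[X in _ = X * _]h; ring.
Qed.

Lemma qterm1_squareE (R : realType) (eps C A : R) n : A != 0 ->
  qterm (eps * A / C ^+ 2) (1 / A ^+ 2) 1 n =
  eps ^+ n / (C ^+ (2 * n) * A ^+ (2 * n ^ 2 + n)
              * qpoch (1 / A ^+ 2) (1 / A ^+ 2) n).
Proof.
move=> A0; rewrite /qterm mul1n !expr_div_n expr1n exprMn -!exprM.
rewrite (_ : 2 * (n ^ 2 + n) = n + (2 * n ^ 2 + n))%N; last lia.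
rewrite (exprD A n) !invfM.
have h : A ^+ n * (A ^+ n)^-1 = 1 by rewrite mulfV// expf_neq0.
by rewrite -[RHS]mul1r -[X in _ = X * _]h; ring.
Qed.

(** The base is now [- (1 / A)], and the signs of its powers are those in the
    series: [n^2] has the parity of [n], and [n^2 + n] is even. *)
Lemma qterm0_altE (R : realType) (C D A : R) n : C != 0 ->
  C * qterm (1 / (C * D)) (- (1 / A)) 0 n =
  (-1) ^+ n / (C ^ (n%:Z - 1) * D ^+ n * A ^+ (n ^ 2)
               * qpoch (- (1 / A)) (- (1 / A)) n).
Proof.
have sgn : (-1) ^+ (n ^ 2) = (-1) ^+ n :> R.
  by rewrite -signr_odd oddX signr_odd.
move=> C0; rewrite /qterm mul0n addn0 [(- (1 / A)) ^+ _]exprNn sgn.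
rewrite !expr_div_n !expr1n exprMn expfzDr// exprN1 -exprnP !invfM invrK.
by ring.
Qed.

Lemma qterm1_altE (R : realType) (C D A : R) n :
  qterm (1 / (C * D)) (- (1 / A)) 1 n =
  1 / ((C * D) ^+ n * A ^+ (n ^ 2 + n) * qpoch (- (1 / A)) (- (1 / A)) n).
Proof.
have sgn : (-1) ^+ (n ^ 2 + n) = 1 :> R.
  by rewrite -signr_odd oddD oddX addbb.
rewrite /qterm mul1n [(- (1 / A)) ^+ _]exprNn sgn mul1r.
by rewrite !mul1r !exprVn !invfM.
Qed.

(** * The five expansions *)

Theorem theorem1 (R : realType) (a : nat) (c d : rat)
    (a_ge2 : (2 <= a)%N)
    (ca_int : c * a%:R \is a Num.int) (ca_gt0 : 0 < c * a%:R)
    (da_int : d * a%:R \is a Num.int) (da_gt0 : 0 < d * a%:R) :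
  let A : R := a%:R in
  let C : R := ratr c in
  let D : R := ratr d in
  [/\ (* (1) *)
      cf_eq_series_ratio
        (cf_blocks [:: 0] (fun k => [tuple D * A ^+ k; C * A ^+ k]))
        (fun n => 1 / (C ^+ n * D ^+ (n + 1) * A ^+ ((n + 1) ^ 2)
                       * qpoch (1 / A) (1 / A) n))
        (fun n => 1 / ((C * D) ^+ n * A ^+ (n ^ 2 + n)
                       * qpoch (1 / A) (1 / A) n)),
      (* (2) *)
      cf_eq_series_ratio
        (cf_blocks [:: 0] (fun k => [tuple C * A ^+ k]))
        (fun n => 1 / (C ^+ (2 * n + 1) * A ^+ (2 * n ^ 2 + 3 * n + 1)
                       * qpoch (1 / A ^+ 2) (1 / A ^+ 2) n))
        (fun n => 1 / (C ^+ (2 * n) * A ^+ (2 * n ^ 2 + n)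
                       * qpoch (1 / A ^+ 2) (1 / A ^+ 2) n)),
      (* (3) *)
      1 < c * a%:R ->
      cf_eq_series_ratio
        (cf_blocks [:: 0; C * A - 1]
                   (fun k => [tuple 1; C * A ^+ (k + 1) - 2]))
        (fun n => (-1) ^+ n / (C ^+ (2 * n + 1) * A ^+ (2 * n ^ 2 + 3 * n + 1)
                       * qpoch (1 / A ^+ 2) (1 / A ^+ 2) n))
        (fun n => (-1) ^+ n / (C ^+ (2 * n) * A ^+ (2 * n ^ 2 + n)
                       * qpoch (1 / A ^+ 2) (1 / A ^+ 2) n)),
      (* (4) *)
      1 < d * a%:R -> 2 < c * a%:R ->
      cf_eq_series_ratio
        (cf_blocks [:: 0; D * A - 1; 1; C * A - 2]
                   (fun k => [tuple 1; D * A ^+ (k + 1) - 2;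
                                    1; C * A ^+ (k + 1) - 2]))
        (fun n => (-1) ^+ n / (C ^+ n * D ^+ (n + 1) * A ^+ ((n + 1) ^ 2)
                       * qpoch (1 / A) (1 / A) n))
        (fun n => (-1) ^+ n / ((C * D) ^+ n * A ^+ (n ^ 2 + n)
                       * qpoch (1 / A) (1 / A) n))
    & (* (5) *)
      c \is a Num.int -> 1 < c -> 1 < d * a%:R ->
      cf_eq_series_ratio
        (cf_blocks [:: C - 1]
                   (fun k => [tuple 1; D * A ^+ k - 1; C * A ^+ k - 1]))
        (fun n => (-1) ^+ n / (C ^ (n%:Z - 1) * D ^+ n * A ^+ (n ^ 2)
                       * qpoch (- (1 / A)) (- (1 / A)) n))
        (fun n => 1 / ((C * D) ^+ n * A ^+ (n ^ 2 + n)
                       * qpoch (- (1 / A)) (- (1 / A)) n))].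
Proof.
move=> A C D.
have pos_ge1 (x : R) : x \is a Num.int -> 0 < x -> 1 <= x.
  by move=> /intrP[z ->]; rewrite ltr0z ler1z.
have gt1_ge2 (x : R) : x \is a Num.int -> 1 < x -> 2 <= x.
  by move=> /intrP[z ->]; rewrite ltr1z (ler_int _ 2).
have gt2_ge3 (x : R) : x \is a Num.int -> 2 < x -> 3 <= x.
  by move=> /intrP[z ->]; rewrite (ltr_int _ 2) (ler_int _ 3).
have A_ge2 : 2 <= A by rewrite /A (ler_nat _ 2).
have A_int : A \is a Num.int by rewrite rpred_nat.
have ratr_int_num (x : rat) : x \is a Num.int -> ratr x \is a @Num.int R.
  by move=> /intrP[z ->]; rewrite ratr_int intr_int.
have ratr_gt (x : rat) k : k%:R < x -> k%:R < ratr x :> R.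
  by rewrite -(ratr_nat R k) ltr_rat.
have ratr_C : ratr (c * a%:R) = C * A by rewrite rmorphM /= ratr_nat.
have ratr_D : ratr (d * a%:R) = D * A by rewrite rmorphM /= ratr_nat.
have CA_int : C * A \is a Num.int by rewrite -ratr_C ratr_int_num.
have DA_int : D * A \is a Num.int by rewrite -ratr_D ratr_int_num.
have CA_gt k : k%:R < c * a%:R -> k%:R < C * A.
  by move=> /ratr_gt; rewrite ratr_C.
have DA_gt k : k%:R < d * a%:R -> k%:R < D * A.
  by move=> /ratr_gt; rewrite ratr_D.
have CA_gt0 : 0 < C * A by exact: (CA_gt 0%N).
have DA_gt0 : 0 < D * A by exact: (DA_gt 0%N).
have C_int : c \is a Num.int -> C \is a Num.int by exact: ratr_int_num.
have C_gt1 : 1 < c -> 1 < C by exact: (ratr_gt _ 1%N).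
(* from here on A, C and D are any reals with these bounds and integrality *)
clearbody A C D; clear ratr_int_num ratr_gt ratr_C ratr_D.
have A_ge1 : 1 <= A by lra.
have A_gt0 : 0 < A by lra.
have AX_int k : A ^+ k \is a Num.int by rewrite rpredX.
have AX_ge1 k : 1 <= A ^+ k by rewrite exprn_ege1.
have AXS_ge2 k : 2 <= A ^+ k.+1.
  by rewrite exprS; have := AX_ge1 k; move: (A ^+ k) => y; nra.
have C_gt0 : 0 < C by rewrite -(pmulr_lgt0 _ A_gt0).
have D_gt0 : 0 < D by rewrite -(pmulr_lgt0 _ A_gt0).
have CA_ge1 : 1 <= C * A by exact: pos_ge1.
have DA_ge1 : 1 <= D * A by exact: pos_ge1.
have [A0 C0 D0] : [/\ A != 0, C != 0 & D != 0] by rewrite !gt_eqF.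
(* the signed expansion C, D A, C A, D A^2, C A^2, ... *)
pose e m := (if odd m then D else C) * A ^+ uphalf m.
have e_odd k : e k.*2.+1 = D * A ^+ k.+1.
  by rewrite /e /= odd_double doubleK.
have e_even k : e k.*2 = C * A ^+ k by rewrite /e odd_double uphalf_double.
have e_gt0 m : 0 < e m by rewrite mulr_gt0 ?exprn_gt0//; case: odd.
have eS m : e m.+1 = (if odd m then C * A else D * A) * A ^+ m./2.
  by rewrite /e uphalfE /= exprS mulrA; case: odd.
have e_int m : e m.+1 \is a Num.int by rewrite eS rpredM//; case: odd.
have e_ge1 m : 1 <= e m.+1.
  by rewrite eS mulr_ege1//; case: odd.
have base_ge1 m : 1 <= (if odd m then C * A else D * A) by case: odd.
have e_ge2 m : 2 <= e m.+3.
  rewrite eS; have := base_ge1 m.+2; have := AXS_ge2 m./2; rewrite /=.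
  by move: (if _ then _ else _) (A ^+ _) => z y; nra.
have eeE m : e m * e m.+1 = C * D * A ^+ m.+1.
  have -> : A ^+ m.+1 = A ^+ (m./2 + odd m) * A * A ^+ m./2.
    rewrite {1}(_ : m.+1 = (m./2 + odd m).+1 + m./2)%N; last by clear; lia.
    by rewrite exprD exprSr.
  rewrite eS /e; have -> : uphalf m = (m./2 + odd m)%N by clear; lia.
  by case: odd; ring.
have invA_le : `|1 / A| <= 1 / 2.
  rewrite !div1r ger0_norm; last by rewrite invr_ge0 ltW.
  by rewrite lef_pV2 ?posrE.
have invA2_le : `|1 / A ^+ 2| <= 1 / 2.
  rewrite !div1r ger0_norm; last by rewrite invr_ge0 exprn_ge0 ?ltW.
  by rewrite lef_pV2 ?posrE ?exprn_gt0// expr2; nra.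
have eps_rel eps m : e m * e m.+1 * (eps / (C * D) * (1 / A) ^+ m.+1) = eps.
  rewrite eeE expr_div_n expr1n; have : A ^+ m.+1 != 0 by rewrite expf_neq0.
  by move: (A ^+ _) => y y0; field; rewrite y0 C0 D0.
(* the signed expansion C, C A, C A^2, ... *)
pose f m := C * A ^+ m.
have f_gt0 m : 0 < f m by rewrite mulr_gt0 ?exprn_gt0.
have fS m : f m.+1 = C * A * A ^+ m by rewrite /f exprS mulrA.
have f_int m : f m.+1 \is a Num.int by rewrite fS rpredM.
have f_rel eps m : f m * f m.+1 *
    (eps * A / C ^+ 2 * (1 / A ^+ 2) ^+ m.+1) = eps.
  rewrite /f expr_div_n expr1n -exprM (_ : (2 * m.+1 = m + m + 2)%N);
    last by clear; lia.
  rewrite !exprD exprS; have : A ^+ m != 0 by rewrite expf_neq0.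
  by move: (A ^+ m) => y y0; field; rewrite y0 C0 A0.
split.
- apply: (@cf_eq_pos _ _ _ _ e (1 / (C * D)) (1 / A)) => //.
  + move=> m; rewrite (@cf_blocks_at _ _ 2 _ m./2 (odd m)); last by case: odd.
      by rewrite eS; case: odd => /=; rewrite exprS mulrA.
    by rewrite /=; clear; lia.
  + by move=> n; rewrite (e_odd 0%N) expr1 qterm2E expr1n.
  + by move=> n; rewrite qterm1E expr1n.
- apply: (@cf_eq_pos _ _ _ _ f (1 * A / C ^+ 2) (1 / A ^+ 2)) => //.
  + by move=> m; rewrite fS mulr_ege1.
  + by move=> m; rewrite fS; have := AXS_ge2 m.+1; move: (A ^+ _) => y; nra.
  + move=> m; rewrite (@cf_blocks_at _ _ 1 _ m 0)//= muln1.
    by rewrite addn0.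
  + by move=> n; rewrite /f expr1 qterm2_squareE ?expr1n.
  + by move=> n; rewrite qterm1_squareE ?expr1n.
- move=> /(CA_gt 1%N)/(gt1_ge2 _ CA_int) CA_ge2.
  apply: (@cf_eq_neg _ _ _ _ f (-1 * A / C ^+ 2) (1 / A ^+ 2)) => //.
  + by move=> m; rewrite fS; have := AXS_ge2 m; move: (A ^+ _) => y; nra.
  + by move=> m; rewrite (@cf_blocks_at _ _ 2 _ m 0).
  + by move=> m; rewrite (@cf_blocks_at _ _ 2 _ m 1)//= addn1.
  + by move=> n; rewrite /f expr1 qterm2_squareE.
  + by move=> n; rewrite qterm1_squareE.
- move=> /(DA_gt 1%N)/(gt1_ge2 _ DA_int) DA_ge2.
  move=> /(CA_gt 2%N)/(gt2_ge3 _ CA_int) CA_ge3.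
  apply: (@cf_eq_neg _ _ _ _ e (-1 / (C * D)) (1 / A)) => //.
  + case=> [|m]; first by rewrite eS mulr1.
    rewrite eS; have := AXS_ge2 m./2; rewrite /=; move: (A ^+ _) => y y_ge2.
    have : 2 <= (if odd m.+2 then C * A else D * A) by case: odd => //; lra.
    by move: (if _ then _ else _) => z; nra.
  (* a block of 4 entries makes two steps of the signed expansion *)
  + case=> [|m] //.
    rewrite (@cf_blocks_at _ _ 4 _ m./2 (odd m).*2); last by case: odd.
      by case: odd.
    by rewrite /=; clear; lia.
  + case=> [|m]; first by rewrite eS mulr1.
    rewrite (@cf_blocks_at _ _ 4 _ m./2 (odd m).*2.+1); last by case: odd.
      by rewrite eS /= negbK addn1; case: odd => /=; rewrite !exprS !mulrA.
    by rewrite /=; clear; lia.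
  + by move=> n; rewrite (e_odd 0%N) expr1 qterm2E.
  + by move=> n; rewrite qterm1E.
- move=> /C_int {}C_int /C_gt1 {}C_gt1 /(DA_gt 1%N)/(gt1_ge2 _ DA_int) DA_ge2.
  apply: (@cf_eq_alt _ _ _ _ e (1 / (C * D)) (- (1 / A))) => //.
  + by rewrite normrN.
  + move=> m; rewrite [(- (1 / A)) ^+ _]exprNn -[RHS]mulr1.
    (* the relation for the base [1 / A], up to the sign *)
    rewrite -[X in _ = _ * X](eps_rel 1 m).
    by rewrite [X in _ * X = _]mulrCA [LHS]mulrCA.
  + by case=> [|m]; rewrite ?(e_even 0%N) ?expr0 ?mulr1.
  + move=> m; rewrite eS; have := AX_ge1 m./2; move: (A ^+ _) => y y_ge1.
    have : 2 <= (if odd m then C * A else D * A) by case: odd => //; nra.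
    by move: (if _ then _ else _) => z; nra.
  + by rewrite (e_even 0%N) expr0 mulr1.
  + by move=> m; rewrite (@cf_blocks_at _ _ 3 _ m 0).
  + by move=> m; rewrite (@cf_blocks_at _ _ 3 _ m 1)//= e_odd.
  + by move=> m; rewrite (@cf_blocks_at _ _ 3 _ m 2)//= -doubleS e_even.
  + by move=> n; rewrite (e_even 0%N) expr0 mulr1 qterm0_altE.
  + by move=> n; rewrite qterm1_altE.
Qed.
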